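(* Let $K$ be a $b$-complete commutative idempotent semiring, let $\{V_\alpha\}_{\alpha\in A}$ be an arbitrary family of $b$-complete idempotent semimodules over $K$, let $V=\prod_\alpha V_\alpha$, and let $\pi\colon V\to\bigotimes_\alpha V_\alpha$, $\pi(x)=\{x\}^\tau$, be the canonical mapping into the $b$-tensor product. Suppose that $W$ is a $b$-complete semimodule over $K$ and there is a $b$-polylinear mapping $\epsilon\colon V\to W$ whose range generates the semimodule $W$, so that each element of $W$ is a linear combination of elements of the form $\epsilon(x)$. Suppose that for each $b$-polylinear mapping $f\colon V\to U$, where $U$ is an arbitrary $b$-complete semimodule over $K$, there exists a $b$-linear mapping $F\colon W\to U$ such that $F\epsilon=f$. Then there exists an isomorphism $\delta\colon W\to\bigotimes_\alpha V_\alpha$ of the semimodule $W$ onto the $b$-tensor product $\bigotimes_\alpha V_\alpha$ such that $\delta\epsilon=\pi$.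
   Context: **Basics.** An idempotent semigroup is a commutative semigroup $(S,\oplus)$ with $x\oplus x=x$; it is ordered by $x\preccurlyeq y\iff x\oplus y=y$, so $x\oplus y=\sup\{x,y\}$. For a subset $X$, $\oplus X$ denotes $\sup X$; ''bounded'' means bounded above. $S$ is $b$-complete if each bounded subset (possibly empty) has a least upper bound; then $S$ has the zero $\mathbf 0=\oplus\emptyset$. An idempotent semiring $K$ is an idempotent semigroup with an associative multiplication $\odot$, distributive on both sides, with unit $\mathbf 1$ and zero $\mathbf 0\ne\mathbf 1$. $K$ is $b$-complete if it is $b$-complete as a semigroup and $k\odot(\oplus X)=\oplus(k\odot X)$, $(\oplus X)\odot k=\oplus(X\odot k)$ for all $k\in K$ and all bounded $X\subset K$. An idempotent semimodule over $K$ is an idempotent semigroup $V$ with an associative multiplication by elements of $K$ that is distributive and satisfies $\mathbf 1\odot x=x$. It is $b$-complete if it is $b$-complete as a semigroup and $(\oplus Q)\odot x=\oplus(Q\odot x)$, $k\odot(\oplus X)=\oplus(k\odot X)$ for all $k\in K$, $x\in V$ and all bounded $Q\subset K$, $X\subset V$. A map $p$ between $b$-complete semimodules is $b$-linear if $p(x\oplus y)=p(x)\oplus p(y)$, $p(k\odot x)=k\odot p(x)$ and $p(\oplus X)=\oplus p(X)$ for every bounded subset $X$. Direct products carry componentwise operations. Linear combinations $\bigoplus_i k_i\odot w_i$, $k_i\in K$, are not necessarily finite. **$b$-polylinear.** A map $f\colon\prod_\alpha V_\alpha\to W$ is $b$-polylinear if for every index $\beta$ and arbitrary fixed values of all other coordinates,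 $x_\beta\mapsto f(\dots,x_\beta,\dots)$ is a $b$-linear map $V_\beta\to W$. **Tensors.** For $k\in K$ and $\alpha\in A$, $k_\alpha\colon V\to V$ multiplies the $\alpha$-th component by $k$ and leaves the others unchanged. A subset $S\subset V$ is an $\alpha$-fiber (or simply a fiber) if all components of its elements with index $\beta\ne\alpha$ are fixed, while the $\alpha$-th component takes arbitrary values in $V_\alpha$. A tensor is a subset $X\subset V$ with the following properties: 1) if $k_\alpha(x)\in X$ for some $\alpha\in A$ and $k\in K$, then $k_\beta(x)\in X$ for all $\beta\in A$; 2) $\oplus(X\cap S)\in X$ for each fiber $S\subset V$; 3) for each fiber $S\subset V$, if $y\in S$, $x\in X\cap S$ and $y\preccurlyeq x$, then $y\in X$. It is assumed that a tensor always contains $\mathbf 0_V$ (formally corresponding to $\sup\emptyset=\mathbf 0_V$). The $\tau$-hull $X^\tau$ of a subset $X\subset V$ is the intersection of all tensors containing $X$. **$b$-tensor product.** A $b$-tensor (bounded tensor) is a tensor contained in $\{x\}^\tau$ for some $x\in V$. $T_b(V)$ is the set of all $b$-tensors ordered by inclusion; this order gives rise to the idempotent addition, the sum of a bounded family being the $\tau$-hull of its union, and $k\odot X=(k_\alpha(X))^\tau$ (independent of the choice of $\alpha$). With these operations $T_b(V)$ is a $b$-complete semimodule over $K$, identified with the $b$-tensor product $\bigotimes_\alpha V_\alpha$; the element $\{x\}^\tau$ with $x=\{x_\alpha\}$ is written $\bigotimes_\alpha x_\alpha$.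
   Formalization: Assumes A nonempty and that T_b(V) is closed under sums with 0⊙X=0 (true for finite A, false if infinitely many V_α are nonzero, where the claim fails); tensor property 2 is read as closure under sups of bounded subsets of X∩S. *)

(* Defs.v *)
From HB Require Import structures.
From mathcomp Require Import all_boot all_order all_algebra.
From mathcomp Require Import boolp classical_sets functions.

Set Implicit Arguments.
Unset Strict Implicit.
Unset Printing Implicit Defensive.

Import GRing.Theory.
Local Open Scope classical_set_scope.
Local Open Scope ring_scope.

Section Order.
Context {T : Type} (le : T -> T -> Prop).
Definition is_ub (X : set T) (u : T) : Prop := forall x, X x -> le x u.
Definition bounded (X : set T) : Prop := exists u, is_ub X u.
Definition is_lub (X : set T) (s : T) : Prop :=
  is_ub X s /\ forall u, is_ub X u -> le s u.
End Order.

Definition ole {M : nmodType} (x y : M) : Prop := x + y = y.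

(* For [X = set0] the least upper bound is the least element, i.e. the neutral
   element [0] of the underlying [nmodType]: no separate axiom identifies the
   zero with [sup set0]. *)
HB.mixin Record isBComplete M of GRing.Nmodule M := {
  oplusxx : forall x : M, x + x = x;
  has_lub : forall X : set M, bounded ole X -> exists s, is_lub ole X s
}.
HB.structure Definition BSemigroup := {M of GRing.Nmodule M & isBComplete M}.

HB.mixin Record isBSemiring K of GRing.ComNzSemiRing K & BSemigroup K := {
  mul_lubr : forall (k : K) (X : set K) s, bounded ole X -> is_lub ole X s ->
    is_lub ole [set k * x | x in X] (k * s);
  mul_lubl : forall (k : K) (X : set K) s, bounded ole X -> is_lub ole X s ->
    is_lub ole [set x * k | x in X] (s * k)
}.
#[short(type="bComSemiRingType")]
HB.structure Definition BComSemiRing :=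
  {K of GRing.ComNzSemiRing K & BSemigroup K & isBSemiring K}.

HB.mixin Record isBSemimodule (K : bComSemiRingType) V
    of GRing.LSemiModule K V & BSemigroup V := {
  scale_lubl : forall (Q : set K) q (x : V), bounded ole Q -> is_lub ole Q q ->
    is_lub ole [set k *: x | k in Q] (q *: x);
  scale_lubr : forall (k : K) (X : set V) s, bounded ole X -> is_lub ole X s ->
    is_lub ole [set k *: x | x in X] (k *: s)
}.
#[short(type="bSemiModType")]
HB.structure Definition BSemimodule (K : bComSemiRingType) :=
  {V of GRing.LSemiModule K V & BSemigroup V & isBSemimodule K V}.

Definition b_linear (K : bComSemiRingType) (V W : bSemiModType K)
    (p : V -> W) : Prop :=
  [/\ forall x y, p (x + y) = p x + p y,
      forall k x, p (k *: x) = k *: p x &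
      forall (X : set V) s, bounded ole X -> is_lub ole X s ->
        is_lub ole [set p x | x in X] (p s)].

Section Tensors.
Context {K : bComSemiRingType} {A : Type} (V : A -> bSemiModType K).

Definition prodV : Type := forall a, V a.
Implicit Types (x y : prodV) (X Y : set prodV).

Definition upd x a (v : V a) : prodV := @dfwith {classic A} V x a v.

Definition b_polylinear (W : bSemiModType K) (f : prodV -> W) : Prop :=
  forall x b, b_linear (fun v : V b => f (upd x v)).

Definition zeroV : prodV := fun a => 0.
Definition ple x y : Prop := forall a, ole (x a) (y a).
Definition cscale (k : K) (a : A) x : prodV := upd x (k *: x a).
Definition fiber (a : A) y : set prodV := [set x | forall b, b <> a -> x b = y b].

(* [X `&` fiber a y] need not be bounded, in which case it has no supremum in
   [V]; [tensor_sup] therefore asks for the suprema of all bounded subsets of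
   [X `&` fiber a y] (a set has a least upper bound iff it is bounded).  If
   [X `&` fiber a y] is itself bounded this is equivalent, given [tensor_down],
   to requiring only its own supremum. *)
Record is_tensor X : Prop := IsTensor {
  tensor0 : X zeroV;
  tensor_scale : forall x k a, X (cscale k a x) -> forall b, X (cscale k b x);
  tensor_sup : forall a y (M : set prodV) s,
    M `<=` X `&` fiber a y -> is_lub ple M s -> X s;
  tensor_down : forall a z x y,
    fiber a z y -> (X `&` fiber a z) x -> ple y x -> X y
}.

Definition hull X : set prodV :=
  [set x | forall T, is_tensor T -> X `<=` T -> T x].

Definition is_btensor X : Prop :=
  is_tensor X /\ exists x, X `<=` hull [set x].

(* These two properties are exactly what is needed for the set of b-tensors,
   with the operations below, to be a semimodule.  [finite_Tb_closed] below
   proves them for every finite index set.  [btensor_scale0] fails whenever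
   infinitely many [V a] are nonzero: the closure conditions of a tensor only
   modify finitely many coordinates, so that the points with finite support form
   a tensor and contain [hull [set zeroV]], whereas [cscale 0 a x] may have
   infinite support. *)
Record Tb_closed : Prop := TbClosed {
  btensor_add : forall X Y,
    is_btensor X -> is_btensor Y -> is_btensor (hull (X `|` Y));
  btensor_scale0 : forall a X,
    is_btensor X -> hull (cscale 0 a @` X) = hull [set zeroV]
}.

Lemma upd_in x a (v : V a) : upd x v a = v.
Proof. exact: (@dfwith_in {classic A} V x a v). Qed.

Lemma upd_out x a (v : V a) b : b <> a -> upd x v b = x b.
Proof.
by move=> ba; apply: (@dfwith_out {classic A} V x a v); apply/eqP => ab; apply: ba.
Qed.

Lemma cscale_in k a x : cscale k a x a = k *: x a.
Proof. exact: upd_in. Qed.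

Lemma cscale_out k a x b : b <> a -> cscale k a x b = x b.
Proof. exact: upd_out. Qed.

Lemma prodV_ext x y : (forall a, x a = y a) -> x = y.
Proof. exact: functional_extensionality_dep. Qed.

Lemma ole_refl (M : BSemigroup.type) (x : M) : ole x x.
Proof. exact: oplusxx. Qed.

Lemma ole_trans (M : BSemigroup.type) (x y z : M) : ole x y -> ole y z -> ole x z.
Proof. by rewrite /ole => xy yz; rewrite -yz addrA xy. Qed.

Lemma ole_anti (M : BSemigroup.type) (x y : M) : ole x y -> ole y x -> x = y.
Proof. by rewrite /ole => xy yx; rewrite -yx addrC xy. Qed.

Lemma ole_addl (M : BSemigroup.type) (x y : M) : ole x (x + y).
Proof. by rewrite /ole addrA oplusxx. Qed.

Lemma ole_addr (M : BSemigroup.type) (x y : M) : ole y (x + y).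
Proof. by rewrite addrC; apply: ole_addl. Qed.

Lemma ole_add (M : BSemigroup.type) (x y z : M) : ole x z -> ole y z -> ole (x + y) z.
Proof. by rewrite /ole => xz yz; rewrite -addrA yz. Qed.

Lemma ole0 (M : BSemigroup.type) (x : M) : ole 0 x.
Proof. exact: add0r. Qed.

Lemma ple_refl x : ple x x. Proof. by move=> a; apply: ole_refl. Qed.

Lemma is_lub_prodP (M : set prodV) s :
  is_lub ple M s <-> forall a, is_lub ole [set x a | x in M] (s a).
Proof.
split=> [[ubs les] a|lubs].
  split=> [_ [x Mx <-]|u ubu]; first exact: ubs.
  have : ple s (upd s u).
    apply: les => x Mx b; case: (pselect (b = a)) => [->|ba].
      by rewrite upd_in; apply: ubu; exists x.
    by rewrite upd_out //; apply: ubs.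
  by move=> /(_ a); rewrite upd_in.
split=> [x Mx a|u ubu a]; first by apply: (lubs a).1; exists x.
by apply: (lubs a).2 => _ [x Mx <-]; apply: ubu.
Qed.

Lemma cscale_zero k a : cscale k a zeroV = zeroV.
Proof.
apply: prodV_ext => b; case: (pselect (b = a)) => [->|ba].
  by rewrite cscale_in /zeroV scaler0.
by rewrite cscale_out.
Qed.

Lemma cscaleC k a l b x : cscale k a (cscale l b x) = cscale l b (cscale k a x).
Proof.
apply: prodV_ext => c.
case: (pselect (c = a)) => [ca|ca]; case: (pselect (c = b)) => [cb|cb].
- by subst a b; rewrite !cscale_in !scalerA mulrC.
- by subst a; rewrite cscale_in !(cscale_out _ _ cb) cscale_in.
- by subst b; rewrite cscale_out // !cscale_in cscale_out.
- by rewrite !cscale_out.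
Qed.

Lemma scale_ole (k : K) (W : bSemiModType K) (x y : W) : ole x y -> ole (k *: x) (k *: y).
Proof. by rewrite /ole => xy; rewrite -scalerDr xy. Qed.

Lemma preim_tensor k a (T : set prodV) :
  is_tensor T -> is_tensor [set x | T (cscale k a x)].
Proof.
move=> TT; split=> /=.
- by rewrite cscale_zero; apply: tensor0.
- move=> x l b; rewrite cscaleC => Tx c; rewrite cscaleC.
  exact: tensor_scale TT _ _ _ Tx _.
- move=> b y M s MS /is_lub_prodP lubs.
  apply: (tensor_sup TT (a := b) (y := cscale k a y) (M := cscale k a @` M)).
    move=> _ [x Mx <-]; have [Tx fx] := MS x Mx; split=> // c cb.
    case: (pselect (c = a)) => [ca|ca].
      by subst c; rewrite !cscale_in fx.
    by rewrite !cscale_out // fx.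
  apply/is_lub_prodP => c.
  case: (pselect (c = a)) => [->|ca]; last first.
    rewrite cscale_out //.
    have -> : [set x c | x in cscale k a @` M] = [set x c | x in M]; last exact: lubs.
    rewrite image_comp; apply: eq_imagel => x _ /=; exact: cscale_out.
  rewrite cscale_in.
  have -> : [set x a | x in cscale k a @` M] = [set k *: v | v in [set x a | x in M]].
    by rewrite !image_comp; apply: eq_imagel => x _ /=; exact: cscale_in.
  by apply: scale_lubr; [exists (s a); case: (lubs a)|exact: lubs].
- move=> b z x y fy [Tx fx] yx.
  apply: (tensor_down TT (a := b) (z := cscale k a z) (x := cscale k a x)).
  + move=> c cb; case: (pselect (c = a)) => [ca|ca].
      by subst c; rewrite !cscale_in fy.
    by rewrite !cscale_out // fy.
  + split=> // c cb; case: (pselect (c = a)) => [ca|ca].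
      by subst c; rewrite !cscale_in fx.
    by rewrite !cscale_out // fx.
  + move=> c; case: (pselect (c = a)) => [->|ca].
      by rewrite !cscale_in; apply: scale_ole.
    by rewrite !cscale_out.
Qed.

Lemma hull_tensor X : is_tensor (hull X).
Proof.
split.
- by move=> T TT _; apply: tensor0.
- by move=> x k a hx b T TT XT; apply: (tensor_scale TT (hx T TT XT)).
- move=> a y M s MS lubs T TT XT; apply: (tensor_sup TT _ lubs) => x Mx.
  by have [hx fx] := MS x Mx; split; [apply: hx|exact: fx].
- move=> a z x y fy [hx fx] yx T TT XT.
  by apply: (tensor_down TT fy _ yx); split; [apply: hx|exact: fx].
Qed.

Lemma sub_hull X : X `<=` hull X. Proof. by move=> x Xx T _; apply. Qed.

Lemma hull_min X Y : is_tensor Y -> X `<=` Y -> hull X `<=` Y.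
Proof. by move=> TY XY x; apply. Qed.

Lemma hull_id X : is_tensor X -> hull X = X.
Proof. by move=> TX; apply/seteqP; split; [apply: hull_min|apply: sub_hull]. Qed.

Lemma hull_eq X Y : X `<=` hull Y -> Y `<=` hull X -> hull X = hull Y.
Proof. by move=> XY YX; apply/seteqP; split; apply: hull_min => //; apply: hull_tensor. Qed.

Lemma hull_cscale k a X : cscale k a @` hull X `<=` hull (cscale k a @` X).
Proof.
move=> _ [x hx <-].
apply: (hull_min (preim_tensor k a (hull_tensor (cscale k a @` X))) _ hx) => y Xy.
by apply: sub_hull; exists y.
Qed.

Lemma hull_cscale_hull k a X : hull (cscale k a @` hull X) = hull (cscale k a @` X).
Proof.
apply: hull_eq; first exact: hull_cscale.
by move=> _ [x Xx <-]; apply: sub_hull; exists x => //; apply: sub_hull.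
Qed.

Lemma hullU_hull X Y : hull (hull X `|` hull Y) = hull (X `|` Y).
Proof.
apply: hull_eq => x [].
- apply: hull_min; first exact: hull_tensor.
  by move=> y Xy; apply: sub_hull; left.
- apply: hull_min; first exact: hull_tensor.
  by move=> y Xy; apply: sub_hull; right.
- by move=> Xx; apply: sub_hull; left; apply: sub_hull.
- by move=> Xx; apply: sub_hull; right; apply: sub_hull.
Qed.

Lemma hull_indep k a b X : hull (cscale k a @` X) = hull (cscale k b @` X).
Proof.
by apply: hull_eq => _ [x Xx <-]; apply: (tensor_scale (hull_tensor _));
  apply: sub_hull; exists x.
Qed.

Lemma btensor_hull1 x : is_btensor (hull [set x]).
Proof. by split; [apply: hull_tensor|exists x]. Qed.

Lemma btensor_cscale k a X : is_btensor X -> is_btensor (hull (cscale k a @` X)).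
Proof.
move=> [TX [x Xx]]; split; first exact: hull_tensor.
exists (cscale k a x); rewrite -(image_set1 (cscale k a) x).
apply: hull_min; first exact: hull_tensor.
by move=> _ [y Xy <-]; apply: hull_cscale; exists y => //; apply: Xx.
Qed.

Lemma tensor_cscale_le T k l a x : is_tensor T -> ole k l ->
  T (cscale l a x) -> T (cscale k a x).
Proof.
move=> TT kl Tx; apply: (tensor_down TT (a := a) (z := x) (x := cscale l a x)).
- by move=> b ba; rewrite cscale_out.
- by split=> // b ba; rewrite cscale_out.
- move=> b; case: (pselect (b = a)) => [->|ba].
    by rewrite !cscale_in /ole -scalerDl kl.
  by rewrite !cscale_out //; apply: ole_refl.
Qed.

Lemma tensor_cscale_lub T (Q : set K) q a x : is_tensor T -> Q !=set0 ->
  is_lub ole Q q -> (forall k, Q k -> T (cscale k a x)) -> T (cscale q a x).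
Proof.
move=> TT [k0 Qk0] lubq TQ.
apply: (tensor_sup TT (a := a) (y := x) (M := [set cscale k a x | k in Q])).
  move=> _ [k Qk <-]; split; first exact: TQ.
  by move=> b ba; rewrite cscale_out.
apply/is_lub_prodP => b; case: (pselect (b = a)) => [->|ba].
  rewrite cscale_in.
  have -> : [set y a | y in [set cscale k a x | k in Q]] = [set k *: x a | k in Q].
    by rewrite image_comp; apply: eq_imagel => k _ /=; exact: cscale_in.
  by apply: scale_lubl => //; exists q; case: lubq.
rewrite cscale_out //; split=> [_ [_ [k Qk <-] <-]|u].
  by rewrite cscale_out //; apply: ole_refl.
by apply; exists (cscale k0 a x); [exists k0|rewrite cscale_out].
Qed.

End Tensors.

Arguments ple {K A V} x y.

Section FiniteIndex.
Context {K : bComSemiRingType} {A : finType} (V : A -> bSemiModType K).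
Implicit Types (x y z : prodV V).

Lemma finite_tensor_down (T : set (prodV V)) x z :
  is_tensor T -> ple x z -> T z -> T x.
Proof.
move=> TT xz Tz; pose w (s : seq A) : prodV V := fun b => if b \in s then x b else z b.
suff Tw s : T (w s).
  have <- : w (enum A) = x by apply: prodV_ext => b; rewrite /w mem_enum.
  exact: Tw.
elim: s => [|c s IHs].
  by have -> : w [::] = z by apply: prodV_ext => b; rewrite /w in_nil.
apply: (tensor_down TT (a := c) (z := w s) (x := w s)) => //.
- by move=> b /eqP bc; rewrite /w in_cons (negbTE bc).
- move=> b; rewrite /w in_cons; case: (b \in s); rewrite ?orbT ?orbF.
    exact: ole_refl.
  by case: ifP => _; [apply: xz|apply: ole_refl].
Qed.

Lemma finite_tensor_zero (T : set (prodV V)) a x : is_tensor T -> T (cscale 0 a x).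
Proof.
move=> TT; pose w (s : seq A) : prodV V :=
  fun b => if (b \in s) && (b != a) then x b else 0.
suff Tw s : T (w s).
  have <- : w (enum A) = cscale 0 a x.
    apply: prodV_ext => b; rewrite /w mem_enum /=; case: eqP => [->|ba].
      by rewrite cscale_in scale0r.
    by rewrite cscale_out.
  exact: Tw.
elim: s => [|c s IHs].
  by have -> : w [::] = zeroV V; [apply: prodV_ext|apply: tensor0].
have [cs|cs] := boolP (c \in s).
  suff -> : w (c :: s) = w s by [].
  by apply: prodV_ext => b; rewrite /w in_cons; case: eqP => //= ->; rewrite cs.
have [ca|ca] := eqVneq c a.
  suff -> : w (c :: s) = w s by [].
  by apply: prodV_ext => b; rewrite /w in_cons; case: eqP => //= ->; rewrite ca eqxx andbF.
have -> : w (c :: s) = cscale 0 a (w (c :: s)).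
  apply: prodV_ext => b; case: (pselect (b = a)) => [->|ba].
    by rewrite cscale_in scale0r /w eqxx andbF.
  by rewrite cscale_out.
apply: (tensor_scale TT (a := c)).
suff -> : cscale 0 c (w (c :: s)) = w s by [].
apply: prodV_ext => b; case: (pselect (b = c)) => [->|bc].
  by rewrite cscale_in scale0r /w (negbTE cs).
by rewrite cscale_out // /w in_cons; move/eqP/negbTE: bc => ->.
Qed.

Theorem finite_Tb_closed : Tb_closed V.
Proof.
split=> [X Y [_ [x Xx]] [_ [y Yy]]|a X _].
  split; first exact: hull_tensor.
  exists (fun a => x a + y a); apply: hull_min; first exact: hull_tensor.
  set z := (X in hull [set X]); have Hz : hull [set z] z by apply: sub_hull.
  move=> t [/Xx|/Yy]; apply: (hull_min (hull_tensor _)) => _ ->;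
    apply: (finite_tensor_down (hull_tensor _) _ Hz) => a.
    exact: ole_addl.
  exact: ole_addr.
apply: hull_eq.
  by move=> _ [x Xx <-]; apply: finite_tensor_zero; apply: hull_tensor.
by move=> _ ->; apply: tensor0; apply: hull_tensor.
Qed.

End FiniteIndex.

(* The index [a0] is the one used to define the multiplication by scalars;
   [bscaleE] shows that every other index gives the same result. *)
Record bTensor (K : bComSemiRingType) (A : Type) (V : A -> bSemiModType K)
    (a0 : A) (h : Tb_closed V) := BTensor {
  btset : set (prodV V);
  btsetP : is_btensor btset
}.

Section BTensorSemimodule.
Context {K : bComSemiRingType} {A : Type} (V : A -> bSemiModType K).
Context (a0 : A) (h : Tb_closed V).
Local Notation Tb := (bTensor a0 h).
Implicit Types X Y Z : Tb.

HB.instance Definition _ := gen_eqMixin Tb.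
HB.instance Definition _ := gen_choiceMixin Tb.

Lemma bTensor_ext X Y : btset X = btset Y -> X = Y.
Proof.
by case: X Y => [X hX] [Y hY] /= E; subst Y; congr BTensor; apply: Prop_irrelevance.
Qed.

Lemma hull_btset X : hull (btset X) = btset X.
Proof. by apply: hull_id; case: (btsetP X). Qed.

Definition bzero : Tb := BTensor a0 h (btensor_hull1 (zeroV V)).
Definition badd X Y : Tb := BTensor a0 h (btensor_add h (btsetP X) (btsetP Y)).
Definition bscale (k : K) X : Tb := BTensor a0 h (btensor_cscale k a0 (btsetP X)).

Lemma baddA : associative badd.
Proof.
move=> X Y Z; apply: bTensor_ext => /=.
by rewrite -{1}(hull_btset X) -{2}(hull_btset Z) !hullU_hull setUA.
Qed.

Lemma baddC : commutative badd.
Proof. by move=> X Y; apply: bTensor_ext => /=; rewrite setUC. Qed.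

Lemma badd0 : left_id bzero badd.
Proof.
move=> X; apply: bTensor_ext => /=; rewrite -[RHS]hull_btset.
apply: hull_eq => x; last by move=> Xx; apply: sub_hull; right.
case=> [|Xx]; last exact: sub_hull.
apply: hull_min; first exact: hull_tensor.
by move=> _ ->; apply: tensor0; apply: hull_tensor.
Qed.

HB.instance Definition _ := GRing.isNmodule.Build Tb baddA baddC badd0.

Lemma bscaleA k l X : bscale k (bscale l X) = bscale (k * l) X.
Proof.
apply: bTensor_ext => /=; rewrite hull_cscale_hull image_comp; congr hull.
apply: eq_imagel => x _ /=; apply: prodV_ext => b.
case: (pselect (b = a0)) => [->|ba]; first by rewrite !cscale_in scalerA.
by rewrite !cscale_out.
Qed.

Lemma bscale0 X : bscale 0 X = 0.
Proof. by apply: bTensor_ext; apply: btensor_scale0 h _ _ (btsetP X). Qed.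

Lemma bscale1 : left_id 1 bscale.
Proof.
move=> X; apply: bTensor_ext => /=; rewrite -[RHS]hull_btset; congr hull.
rewrite -[RHS]image_id; apply: eq_imagel => x _; apply: prodV_ext => b.
case: (pselect (b = a0)) => [->|ba]; first by rewrite cscale_in scale1r.
by rewrite cscale_out.
Qed.

Lemma bscaleDr : right_distributive bscale +%R.
Proof.
by move=> k X Y; apply: bTensor_ext => /=; rewrite hull_cscale_hull hullU_hull image_setU.
Qed.

Lemma bscaleDl X : {morph bscale^~ X : k l / k + l}.
Proof.
move=> k l; apply: bTensor_ext => /=; rewrite hullU_hull; apply: hull_eq.
  move=> _ [x Xx <-].
  apply: (tensor_cscale_lub (Q := [set m | m = k \/ m = l]) (hull_tensor _)).
  - by exists k; left.
  - split=> [_ [->|->]|u ubu]; [exact: ole_addl|exact: ole_addr|].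
    by apply: ole_add; apply: ubu; [left|right].
  - by move=> _ [->|->]; apply: sub_hull; [left|right]; exists x.
move=> _ [] [x Xx <-]; apply: (tensor_cscale_le (l := k + l) (hull_tensor _));
  by [apply: ole_addl|apply: ole_addr|apply: sub_hull; exists x].
Qed.

HB.instance Definition _ := GRing.Nmodule_isLSemiModule.Build K Tb
  bscaleA bscale0 bscale1 bscaleDr bscaleDl.

Lemma btset_add X Y : btset (X + Y) = hull (btset X `|` btset Y).
Proof. by []. Qed.

Lemma bscaleE (k : K) X a : btset (k *: X) = hull (cscale k a @` btset X).
Proof. exact: hull_indep. Qed.

Lemma bTensor_oleP X Y : ole X Y <-> btset X `<=` btset Y.
Proof.
split=> [<-|XY]; first by rewrite btset_add => x Xx; apply: sub_hull; left.
by apply: bTensor_ext; rewrite btset_add setUidr // hull_btset.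
Qed.

Lemma bTensor_addxx X : X + X = X.
Proof. by apply: bTensor_ext; rewrite btset_add setUid hull_btset. Qed.

Lemma bTensor_lubP (F : set Tb) X :
  bounded ole F ->
  is_lub ole F X <-> btset X = hull (\bigcup_(Y in F) btset Y).
Proof.
move=> [B FB]; pose U := hull (\bigcup_(Y in F) btset Y).
have UB : U `<=` btset B.
  apply: hull_min; first by case: (btsetP B).
  by move=> x [Y FY Yx]; move/bTensor_oleP: (FB Y FY); apply.
have bU : is_btensor U.
  split; first exact: hull_tensor.
  by have [_ [x Bx]] := btsetP B; exists x => y /UB /Bx.
split=> [[ubX leX]|EX].
  apply/seteqP; split.
    have /bTensor_oleP // : ole X (BTensor a0 h bU).
    apply: leX => Y FY; apply/bTensor_oleP => x Yx /=.
    by apply: sub_hull; exists Y.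
  apply: hull_min; first by case: (btsetP X).
  by move=> x [Y FY Yx]; move/bTensor_oleP: (ubX Y FY); apply.
split=> [Y FY|Z ubZ]; apply/bTensor_oleP; rewrite EX.
  by move=> x Yx; apply: sub_hull; exists Y.
apply: hull_min; first by case: (btsetP Z).
by move=> x [Y FY Yx]; move/bTensor_oleP: (ubZ Y FY); apply.
Qed.

Lemma bTensor_has_lub (F : set Tb) : bounded ole F -> exists s, is_lub ole F s.
Proof.
move=> bF; have [B FB] := bF; pose U := hull (\bigcup_(Y in F) btset Y).
have bU : is_btensor U.
  split; first exact: hull_tensor.
  have [TB [x Bx]] := btsetP B; exists x; apply: hull_min; first exact: hull_tensor.
  by move=> y [Y FY Yy]; apply: Bx; move/bTensor_oleP: (FB Y FY); apply.
by exists (BTensor a0 h bU); apply/bTensor_lubP.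
Qed.

HB.instance Definition _ := isBComplete.Build Tb bTensor_addxx bTensor_has_lub.

Lemma bTensor_scale_lubl (Q : set K) q X : bounded ole Q -> is_lub ole Q q ->
  is_lub ole [set k *: X | k in Q] (q *: X).
Proof.
move=> _ lubq; split=> [_ [k Qk <-]|Z ubZ].
  by rewrite /ole -scalerDl (lubq.1 k Qk).
case: (pselect (Q !=set0)) => [Q0|/set0P/negP/negPn/eqP Q0].
  apply/bTensor_oleP; have [TZ _] := btsetP Z.
  apply: hull_min => // _ [x Xx <-].
  apply: (tensor_cscale_lub TZ Q0 lubq) => k Qk.
  have /bTensor_oleP : ole (k *: X) Z by apply: ubZ; exists k.
  by apply; apply: sub_hull; exists x.
have -> : q = 0.
  apply: ole_anti; last exact: ole0.
  by apply: lubq.2 => k; rewrite Q0.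
by rewrite scale0r; apply: ole0.
Qed.

Lemma bTensor_scale_lubr (k : K) (F : set Tb) S : bounded ole F -> is_lub ole F S ->
  is_lub ole [set k *: X | X in F] (k *: S).
Proof.
move=> bF lubS; have /(bTensor_lubP S bF) ES := lubS.
have ubS : is_ub ole [set k *: X | X in F] (k *: S).
  by move=> _ [X FX <-]; rewrite /ole -scalerDr (lubS.1 X FX).
apply/bTensor_lubP; first by exists (k *: S).
rewrite (bscaleE _ _ a0) ES hull_cscale_hull; apply: hull_eq.
  move=> _ [x [X FX Xx] <-]; apply: sub_hull; exists (k *: X); first by exists X.
  by apply: sub_hull; exists x.
move=> x [_ [X FX <-]]; apply: hull_min; first exact: hull_tensor.
by move=> _ [y Xy <-]; apply: sub_hull; exists y => //; exists X.
Qed.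

HB.instance Definition _ := isBSemimodule.Build K Tb
  bTensor_scale_lubl bTensor_scale_lubr.

Definition bpi (x : prodV V) : Tb := BTensor a0 h (btensor_hull1 x).

End BTensorSemimodule.

Arguments bpi {K A V} a0 h x.

(* [W] is generated by the range of [eps]; the families of scalars and vectors
   in a linear combination may be infinite. *)
Definition generates (K : bComSemiRingType) (W : bSemiModType K) (P : Type)
    (eps : P -> W) : Prop :=
  forall w : W, exists (I : Type) (k : I -> K) (x : I -> P),
    is_lub ole [set k i *: eps (x i) | i in [set: I]] w.

(* Main.v *)
Require Import Defs.
From mathcomp Require Import all_boot.
From mathcomp Require Import ssralg boolp classical_sets.

Set Implicit Arguments.
Unset Strict Implicit.
Unset Printing Implicit Defensive.

Import GRing.Theory.
Local Open Scope classical_set_scope.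
Local Open Scope ring_scope.

(** For [w] in [W] the points [x] with [eps x <= w] form a tensor.  Hence [eps] is
    bounded on every b-tensor [X], and [X |-> sup (eps X)] is well defined; it
    inverts the map [delta] obtained by factoring the canonical map [bpi], which
    is b-polylinear, through [eps]. *)

Lemma lub_unique (M : BSemigroup.type) (X : set M) s t :
  is_lub ole X s -> is_lub ole X t -> s = t.
Proof. by move=> [us ls] [ut lt]; apply: ole_anti; [apply: ls|apply: lt]. Qed.

Lemma lub_set0 (M : BSemigroup.type) (s : M) : is_lub ole set0 s -> s = 0.
Proof. by case=> _ ls; apply: ole_anti; [apply: ls|apply: ole0]. Qed.

Lemma lub_pair (M : BSemigroup.type) (x y : M) : is_lub ole [set x; y] (x + y).
Proof.
split=> [_ [->|->]|u ub]; [exact: ole_addl|exact: ole_addr|].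
by apply: ole_add; apply: ub; [left|right].
Qed.

Lemma b_linear_mono (K : bComSemiRingType) (U W : bSemiModType K) (p : U -> W) :
  b_linear p -> {homo p : x y / ole x y}.
Proof. by case=> pD _ _ x y; rewrite /ole => xy; rewrite -pD xy. Qed.

(** Additivity is the case of a two-element set, whose least upper bound is the sum. *)
Lemma b_linear_of_lub (K : bComSemiRingType) (U W : bSemiModType K) (p : U -> W) :
  (forall k x, p (k *: x) = k *: p x) ->
  (forall (X : set U) s, is_lub ole X s -> is_lub ole [set p x | x in X] (p s)) ->
  b_linear p.
Proof.
move=> pZ plub; split=> // [x y|X s _]; last exact: plub.
apply: lub_unique (lub_pair _ _).
have /plub := lub_pair x y.
by rewrite image_setU !image_set1.
Qed.

Section Updates.
Context {K : bComSemiRingType} {A : Type} {V : A -> bSemiModType K}.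
Implicit Types (x y : prodV V).

Lemma upd_id x a : upd x (x a) = x.
Proof.
apply: prodV_ext => b; case: (pselect (b = a)) => [->|ba].
  by rewrite upd_in.
by rewrite upd_out.
Qed.

Lemma fiber_upd x y a : fiber a y x -> upd y (x a) = x.
Proof.
move=> fx; apply: prodV_ext => b; case: (pselect (b = a)) => [->|ba].
  by rewrite upd_in.
by rewrite upd_out // fx.
Qed.

Lemma upd_fiber x a (v : V a) : fiber a x (upd x v).
Proof. by move=> b; apply: upd_out. Qed.

Lemma cscale_upd k x a (v : V a) : cscale k a (upd x v) = upd x (k *: v).
Proof.
apply: prodV_ext => b; case: (pselect (b = a)) => [->|ba].
  by rewrite cscale_in !upd_in.
by rewrite cscale_out // !upd_out.
Qed.

Lemma upd_mono x a (v w : V a) : ole v w -> ple (upd x v) (upd x w).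
Proof.
move=> vw b; case: (pselect (b = a)) => [->|ba]; first by rewrite !upd_in.
by rewrite !upd_out //; apply: ole_refl.
Qed.

(** Nonemptiness matters off [a]: the supremum of the empty set is [zeroV], which need not agree
    with [x] there. *)
Lemma lub_upd x a (X : set (V a)) s : X !=set0 -> is_lub ole X s ->
  is_lub ple [set upd x v | v in X] (upd x s).
Proof.
move=> [v0 Xv0] lubs; split=> [_ [v Xv <-]|u ubu b].
  exact/upd_mono/lubs.1.
case: (pselect (b = a)) => [->|ba].
  rewrite upd_in; apply: lubs.2 => v Xv.
  by rewrite -(upd_in x v); apply: ubu; exists v.
by rewrite upd_out // -(upd_out x v0 ba); apply: ubu; exists v0.
Qed.

End Updates.

Section PolylinearMaps.
Context {K : bComSemiRingType} {A : Type} {V : A -> bSemiModType K}.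
Context {W : bSemiModType K} {f : prodV V -> W} (hf : b_polylinear f).

Lemma polylinear_cscale k a x : f (cscale k a x) = k *: f x.
Proof. by have [_ fZ _] := hf x a; rewrite /cscale fZ upd_id. Qed.

(** Scaling one coordinate by 0 fixes [zeroV], and the factor 0 can be pulled out of [f]. An index
    must exist: over an empty [A] every map is b-polylinear. *)
Lemma polylinear_zeroV (a : A) : f (zeroV V) = 0.
Proof. by rewrite -(cscale_zero V 0 a) polylinear_cscale scale0r. Qed.

(** Each closure property of a tensor mirrors one property of [f]: a scalar gives the same factor at
    every index, and in each single coordinate [f] preserves bounded suprema and is monotone. *)
Lemma lower_set_tensor (a0 : A) (w : W) : is_tensor [set x | ole (f x) w].
Proof.
split=> /= [|x k a + b|a y M s MS lubs|a z x y fy [fw fx] yx].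
- by rewrite (polylinear_zeroV a0); apply: ole0.
- by rewrite !polylinear_cscale.
- have lubc := (is_lub_prodP M s).1 lubs.
  case: (pselect (M !=set0)) => [[x0 Mx0]|/set0P/negP/negPn/eqP M0]; last first.
    suff -> : s = zeroV V by rewrite (polylinear_zeroV a0); apply: ole0.
    by apply: prodV_ext => b; apply: lub_set0; have := lubc b; rewrite M0 image_set0.
  (* Off [a] all points of the nonempty [M] share the coordinates of [y], hence so does their
     supremum. *)
  have fs : fiber a y s.
    move=> b ba; have [_ fx0] := MS x0 Mx0.
    apply: ole_anti; last by rewrite -(fx0 b ba); apply: (lubc b).1; exists x0.
    by apply: (lubc b).2 => _ [x Mx <-]; rewrite ((MS x Mx).2 b ba); apply: ole_refl.
  have [_ _ flub] := hf y a.
  have bM : bounded ole [set x a | x in M] by exists (s a); case: (lubc a).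
  have [_] := flub _ _ bM (lubc a); rewrite (fiber_upd fs); apply.
  move=> _ [_ [x Mx <-] <-]; have [xw fx] := MS x Mx.
  by rewrite (fiber_upd fx).
- apply: ole_trans fw; have := b_linear_mono (hf z a) (yx a).
  by rewrite (fiber_upd fy) (fiber_upd fx).
Qed.

Lemma bounded_image_btensor (a0 : A) X : is_btensor X -> bounded ole [set f x | x in X].
Proof.
move=> [_ [x0 Xx0]]; exists (f x0) => _ [x /Xx0 hx <-].
apply: (hull_min (lower_set_tensor a0 (f x0)) _ hx) => _ -> /=.
exact: ole_refl.
Qed.

End PolylinearMaps.

Section CanonicalMap.
Context {K : bComSemiRingType} {A : Type} {V : A -> bSemiModType K}.
Context (a0 : A) (hT : Tb_closed V).
Local Notation pi := (bpi a0 hT).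

(** The hull of a point is the least tensor containing it, so inequalities between b-tensors turn
    into membership of points. *)
Lemma bpi_oleP x (Z : bTensor a0 hT) : ole (pi x) Z <-> btset Z x.
Proof.
rewrite bTensor_oleP; split=> [|Zx]; first by apply; apply: sub_hull.
by apply: hull_min; [case: (btsetP Z)|move=> _ ->].
Qed.

Lemma bpi_lub (X : bTensor a0 hT) : is_lub ole [set pi x | x in btset X] X.
Proof.
split=> [_ [x Xx <-]|Z ubZ]; first exact/bpi_oleP.
by apply/bTensor_oleP => x Xx; apply/bpi_oleP/ubZ; exists x.
Qed.

Lemma bpi_cscale k a x : pi (cscale k a x) = k *: pi x.
Proof.
by apply: bTensor_ext; rewrite (bscaleE _ _ a) hull_cscale_hull image_set1.
Qed.

(** In terms of membership, the upper bound half is [tensor_down] for the hull of [upd x s], and the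
    leastness half is [tensor_sup] for [Z]. *)
Lemma bpi_polylinear : b_polylinear pi.
Proof.
move=> x a; apply: b_linear_of_lub => [k v|X s lubs].
  by rewrite -cscale_upd bpi_cscale.
split=> [_ [v Xv <-]|Z ubZ]; apply/bpi_oleP.
  apply: (tensor_down (hull_tensor _) (a := a) (z := x) (x := upd x s)).
  - exact: upd_fiber.
  - by split; [apply: sub_hull|apply: upd_fiber].
  - exact/upd_mono/lubs.1.
have [TZ _] := btsetP Z.
case: (pselect (X !=set0)) => [X0|/set0P/negP/negPn/eqP X0]; last first.
  move: lubs; rewrite X0 => /lub_set0 ->.
  (* The point [upd x 0] is [cscale 0 a x], so its class is the zero b-tensor. *)
  apply/bpi_oleP; rewrite -(scale0r (x a)) bpi_cscale scale0r.
  exact: ole0.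
apply: (tensor_sup TZ _ (lub_upd x X0 lubs)) => _ [v Xv <-].
by split; [apply/bpi_oleP/ubZ; exists v|apply: upd_fiber].
Qed.

End CanonicalMap.

Theorem theorem2 (K : bComSemiRingType) (A : Type) (a0 : A)
    (V : A -> bSemiModType K) (hT : Tb_closed V)
    (W : bSemiModType K) (eps : prodV V -> W)
    (heps : b_polylinear eps) (hgen : generates eps)
    (huniv : forall (U : bSemiModType K) (f : prodV V -> U), b_polylinear f ->
       exists F : W -> U, b_linear F /\ forall x, F (eps x) = f x) :
  exists delta : W -> bTensor a0 hT,
    [/\ b_linear delta, bijective delta &
        forall x, delta (eps x) = bpi a0 hT x].
Proof.
have [delta [lin deltaE]] := huniv _ _ (bpi_polylinear a0 hT).
exists delta; split=> //.
have bE (X : bTensor a0 hT) : bounded ole [set eps x | x in btset X].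
  exact: bounded_image_btensor heps a0 _ (btsetP X).
have [G GP] := choice (fun X => has_lub _ (bE X)).
have [_ deltaZ deltalub] := lin.
exists G => [w|X]; last first.
  (* [delta] carries the supremum defining [G X] to the supremum of the classes [pi x] for [x] in
     [X], which is [X] itself. *)
  have := deltalub _ _ (bE X) (GP X); rewrite image_comp.
  under eq_imagel do rewrite /= deltaE.
  by move=> /lub_unique; apply; apply: bpi_lub.
have [I [k [x lubw]]] := hgen w.
have kxw i : ole (k i *: eps (x i)) w by apply: lubw.1; exists i.
(* Coefficients are absorbed into the points, so [w] becomes a supremum of values of [eps]. *)
have ke i : eps (cscale (k i) a0 (x i)) = k i *: eps (x i).
  exact: polylinear_cscale.
apply: ole_anti.
  (* [delta w] is the hull of the classes of these points. All of them lie in the tensor of points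
     that [eps] sends below [w], hence so does [delta w]. *)
  have Tw := lower_set_tensor heps a0 w.
  have bw : bounded ole [set k i *: eps (x i) | i in setT] by exists w; case: lubw.
  have lubd := deltalub _ _ bw lubw.
  have bd := ex_intro (is_ub ole _) _ lubd.1.
  apply: (GP _).2 => _ [y + <-].
  rewrite (iffLR (bTensor_lubP _ bd) lubd); apply: (hull_min Tw).
  move=> z [_ [_ [i _ <-] <-]]; rewrite -ke deltaE; apply: (hull_min Tw) => _ -> /=.
  by rewrite ke.
(* Conversely, each of these points belongs to [delta w] by monotonicity of [delta], so its value is
   below the supremum [G (delta w)]. *)
apply: lubw.2 => _ [i _ <-]; rewrite -ke; apply: (GP _).1.
exists (cscale (k i) a0 (x i)) => //.
by apply/bpi_oleP; rewrite -deltaE ke; apply: b_linear_mono.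
Qed.
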